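(* Let $f\in\mathcal G(\mathbb R)$. If $f$ is periodic with (real) periods $h_1$ and $h_2$, i.e. $f(x+h_1)=f(x)$ and $f(x+h_2)=f(x)$ hold as equalities in $\mathcal G(\mathbb R)$, where $h_1/h_2$ is a positive irrational algebraic number, then $f$ is a generalized constant.
   Context: The special Colombeau algebra on $\mathbb R$: let $\mathcal E(\mathbb R)$ be the algebra of all nets $(u_\varepsilon)_{\varepsilon\in(0,1)}$ of $\mathcal C^\infty$-functions $\mathbb R\to\mathbb C$. Let $\mathcal E_M(\mathbb R)$ be the set of $(u_\varepsilon)_\varepsilon\in\mathcal E(\mathbb R)$ such that for every compact $K\subset\mathbb R$ and every $k\in\mathbb N$ there exists $b\in\mathbb R$ with $\sup_{x\in K}|u_\varepsilon^{(k)}(x)|=O(\varepsilon^b)$ as $\varepsilon\to0$. Let $\mathcal N(\mathbb R)$ be the set of those $(u_\varepsilon)_\varepsilon\in\mathcal E(\mathbb R)$ such that for every compact $K$, every $k\in\mathbb N$ and every $b\in\mathbb R$, $\sup_{x\in K}|u_\varepsilon^{(k)}(x)|=O(\varepsilon^b)$ as $\varepsilon\to0$. Then $\mathcal G(\mathbb R)=\mathcal E_M(\mathbb R)/\mathcal N(\mathbb R)$. For $h\in\mathbb R$, $f(x+h)$ denotes the class of $(x\mapsto f_\varepsilon(x+h))_\varepsilon$, where $(f_\varepsilon)_\varepsilon$ is a representative of $f$. $f$ is a generalized constant if, for a representative $(f_\varepsilon)_\varepsilon$ of $f$, the net $(f_\varepsilon-f_\varepsilon(0))_\varepsilon$ belongs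 to $\mathcal N(\mathbb R)$. *)

(* Defs.v *)
From HB Require Import structures.
From mathcomp Require Import all_boot all_order all_algebra generic_quotient.
From mathcomp Require Import ring_quotient complex.
From mathcomp Require Import all_classical all_reals all_analysis.

Set Implicit Arguments.
Unset Strict Implicit.
Unset Printing Implicit Defensive.

Import Order.TTheory GRing.Theory Num.Theory.
Import numFieldNormedType.Exports.

Local Open Scope classical_set_scope.
Local Open Scope ring_scope.
Local Open Scope quotient_scope.

(* [Rcomplex R] is [R[i]] seen as a vector space over [R]; its norm is the
   modulus, with values in [R]. *)
Section Rcomplex_normedMod.
Variable R : realType.

HB.instance Definition _ :=
  PseudoMetric.copy (Rcomplex R) (pseudoMetric_normed (Rcomplex R)).

HB.instance Definition _ := isPointed.Build (Rcomplex R) 0.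

HB.instance Definition _ := NormedZmod_PseudoMetric_eq.Build R (Rcomplex R) erefl.

Let normrZ (l : R) (x : Rcomplex R) : `|l *: x| = `|l| * `|x|.
Proof.
have -> : l *: x = (real_complex R l : Rcomplex R) * x.
  case: x => a b; rewrite /GRing.mul /GRing.scale /= !mul0r subr0 addr0 //.
rewrite /Num.norm /= Normc.normcM; congr (_ * _).
by rewrite /Normc.normc /= expr0n /= addr0 sqrtr_sqr.
Qed.

HB.instance Definition _ :=
  PseudoMetricNormedZmod_Lmodule_isNormedModule.Build R (Rcomplex R) normrZ.

Lemma Rcomplex_normM (x y : Rcomplex R) :
  `|x * y : Rcomplex R| = `|x| * `|y| :> R.
Proof. exact: Normc.normcM. Qed.

Lemma Rcomplex_norm1 : `|(1 : Rcomplex R)| = 1 :> R.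
Proof. by rewrite /Num.norm /= expr0n /= addr0 expr1n sqrtr1. Qed.

Lemma Rcomplex_scaleAl (a : R) (x y : Rcomplex R) :
  a *: (x * y : Rcomplex R) = (a *: x) * y.
Proof. exact: scalerAl. Qed.

End Rcomplex_normedMod.

Section Derivatives.
Variable R : realType.
Local Notation C := (Rcomplex R).
Implicit Types (g f : R -> C).

Lemma Rcomplex_cvgM (T : Type) (F : set_system T) {FF : Filter F}
    (a b : T -> C) (la lb : C) :
  a @ F --> la -> b @ F --> lb -> (fun t => a t * b t : C) @ F --> (la * lb : C).
Proof.
move=> ca cb.
have na : `|a t - la| @[t --> F] --> (0 : R).
  by apply/norm_cvg0P/subr_cvg0.
have nb : `|b t - lb| @[t --> F] --> (0 : R).
  by apply/norm_cvg0P/subr_cvg0.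
apply: (iffLR (@subr_cvg0 _ C T F FF _ _)); apply: norm_cvg0.
apply: (@squeeze_cvgr T F FF R (cst 0)
  (fun t => `|a t - la| * `|b t - lb| + `|la| * `|b t - lb| + `|a t - la| * `|lb|)).
- apply: nearW => t; rewrite normr_ge0 /= -!Rcomplex_normM.
  rewrite (_ : a t * b t - la * lb =
    (a t - la) * (b t - lb) + la * (b t - lb) + (a t - la) * lb); last first.
    rewrite -mulrDl subrK !mulrBr mulrBl; set X := _ * _; set Y := _ * _.
    by rewrite addrA subrK.
  rewrite (le_trans (ler_normD _ _)) // lerD2r.
  by rewrite (le_trans (ler_normD _ _)).
- exact: cvg_cst.
- rewrite [X in _ --> X](_ : _ = 0 * 0 + `|la| * 0 + 0 * `|lb|); last first.
    by rewrite !(mulr0, mul0r, addr0).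
  apply: cvgD; first (apply: cvgD).
  + exact: cvgM.
  + by apply: cvgM => //; exact: cvg_cst.
  + by apply: cvgM => //; exact: cvg_cst.
Qed.

Lemma is_derive1M f g x : derivable f x 1 -> derivable g x 1 ->
  is_derive x 1 (f * g) (derive1 f x * g x + f x * derive1 g x).
Proof.
move=> df dg.
have cf : f (h + x) @[h --> (0 : R)^'] --> f x.
  have : {for x, continuous f} by exact/differentiable_continuous/derivable1_diffP.
  move=> cf; have : f (h + x) @[h --> (0 : R)] --> f x.
    apply: continuous_cvg => //; rewrite -{2}[x]add0r.
    by apply: cvgD; [exact: cvg_id | exact: cvg_cst].
  by apply: cvg_trans; apply: cvg_app; exact: nbhs_dnbhs.
have Df : h^-1 *: (f (h + x) - f x) @[h --> (0 : R)^'] --> derive1 f x.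
  rewrite derive1E; move: df => /cvg_ex [l hl]; rewrite /derive (cvg_lim _ hl) //.
  by move: hl; under eq_fun do rewrite /= [_%:A]mulr1.
have Dg : h^-1 *: (g (h + x) - g x) @[h --> (0 : R)^'] --> derive1 g x.
  rewrite derive1E; move: dg => /cvg_ex [l hl]; rewrite /derive (cvg_lim _ hl) //.
  by move: hl; under eq_fun do rewrite /= [_%:A]mulr1.
have key : h^-1 *: (((f * g) \o shift x) (h *: 1) - (f * g) x) @[h --> (0 : R)^'] -->
    (derive1 f x * g x + f x * derive1 g x : C).
  rewrite addrC.
  have H := cvgD (Rcomplex_cvgM cf Dg) (Rcomplex_cvgM Df (cvg_cst (g x))).
  have {}H := H _ _ _ _.
  apply: cvg_trans; last exact: H.
  apply: near_eq_cvg; apply: nearW => h.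
  rewrite /= [h%:A]mulr1 -[LHS]/(f (h + x) * (h^-1 *: (g (h + x) - g x)) +
    h^-1 *: (f (h + x) - f x) * g x : C).
  rewrite [X in X + _]mulrC -!Rcomplex_scaleAl -scalerDr.
  congr (_ *: _); rewrite [X in X + _]mulrC mulrBr mulrBl addrA subrK //.
apply: DeriveDef; first by apply/cvg_ex; eexists; exact: key.
exact: cvg_lim key.
Qed.

(* A curve all of whose iterated derivatives exist is of class C^oo. The iterated
   derivatives [derive1n k f] are total, hence the explicit derivability. *)
Definition smooth f := forall k x, derivable (derive1n k f) x 1.

Lemma smooth_derive1 f : smooth f -> smooth (derive1 f).
Proof. by move=> sf k x; rewrite -derive1Sn. Qed.

Lemma smoothP f : (forall x, derivable f x 1) -> smooth (derive1 f) -> smooth f.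
Proof. by move=> df sf [|k] x //; rewrite derive1Sn. Qed.

Lemma smooth_derivable f x : smooth f -> derivable f x 1.
Proof. by move=> /(_ 0). Qed.

Lemma smooth_continuous f k : smooth f -> continuous (derive1n k f).
Proof.
by move=> sf x; exact/differentiable_continuous/derivable1_diffP.
Qed.

Lemma derive1_cst (c : C) : derive1 (cst c : R -> C) = cst 0.
Proof. by apply/funext => x; rewrite derive1E derive_cst. Qed.

Lemma derive1n_cst (c : C) k : derive1n k.+1 (cst c : R -> C) = cst 0.
Proof. by elim: k => [|k IH]; rewrite derive1nS ?derive1n0 ?IH derive1_cst. Qed.

Lemma smooth_cst (c : C) : smooth (cst c).
Proof.
by move=> [|k] x; rewrite ?derive1n_cst ?derive1n0; exact: derivable_cst.
Qed.

Definition smooth_upto n f :=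
  forall k x, (k < n)%N -> derivable (derive1n k f) x 1.

Lemma smooth_upto_lt m n f : (m <= n)%N -> smooth_upto n f -> smooth_upto m f.
Proof. by move=> mn sf k x km; apply: sf; exact: leq_trans mn. Qed.

Lemma derive1nD_upto f g n : smooth_upto n f -> smooth_upto n g ->
  derive1n n (f + g) = derive1n n f + derive1n n g.
Proof.
elim: n => [//|k IH] sf sg; rewrite !derive1nS IH.
- apply/funext => x; rewrite derive1E deriveD; [|exact: sf|exact: sg].
  by rewrite -!derive1E.
- exact: smooth_upto_lt sf.
- exact: smooth_upto_lt sg.
Qed.

Lemma derive1nD f g k : smooth f -> smooth g ->
  derive1n k (f + g) = derive1n k f + derive1n k g.
Proof. by move=> sf sg; apply: derive1nD_upto => j x _; auto. Qed.

Lemma derive1nB f g k : smooth f -> smooth g ->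
  derive1n k (f - g) = derive1n k f - derive1n k g.
Proof.
move=> sf sg; elim: k => [//|k IH]; rewrite !derive1nS IH.
by apply/funext => x; rewrite derive1E deriveB // -!derive1E.
Qed.

Lemma smoothB f g : smooth f -> smooth g -> smooth (f - g).
Proof. by move=> sf sg k x; rewrite derive1nB //; exact: derivableB. Qed.

Lemma smoothD f g : smooth f -> smooth g -> smooth (f + g).
Proof. by move=> sf sg k x; rewrite derive1nD //; exact: derivableD. Qed.

Lemma derive1_mul f g : smooth f -> smooth g ->
  derive1 (f * g) = derive1 f * g + f * derive1 g.
Proof.
move=> sf sg; apply/funext => x; rewrite derive1E.
have H := is_derive1M (@smooth_derivable _ x sf) (@smooth_derivable _ x sg).
by rewrite derive_val.
Qed.

Lemma smoothM f g : smooth f -> smooth g -> smooth (f * g).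
Proof.
suff H n : forall f g, smooth f -> smooth g -> smooth_upto n (f * g).
  by move=> sf sg k x; exact: (H k.+1).
elim: n => [//|n IH] {}f {}g sf sg [|k] x kn.
  by have [] := is_derive1M (@smooth_derivable _ x sf) (@smooth_derivable _ x sg).
rewrite derive1Sn derive1_mul //.
have s1 := IH _ _ (smooth_derive1 sf) sg.
have s2 := IH _ _ sf (smooth_derive1 sg).
rewrite derive1nD_upto; last 2 first.
- by apply: smooth_upto_lt s1; rewrite -ltnS ltnW.
- by apply: smooth_upto_lt s2; rewrite -ltnS ltnW.
by apply: derivableD; [exact: s1 | exact: s2].
Qed.

Lemma derive1n_shift f h k :
  derive1n k (fun x => f (x + h)) = (fun x => derive1n k f (x + h)).
Proof.
elim: k => [//|k IH]; rewrite !derive1nS IH; apply/funext => x.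
rewrite /derive1 (_ : (fun t => t^-1 *: _) =
  (fun t : R => t^-1 *: (derive1n k f (t + (x + h)) - derive1n k f (x + h)))) //.
by apply/funext => t; rewrite addrA.
Qed.

Lemma derivable_shift f h x :
  derivable f (x + h) 1 -> derivable (fun y => f (y + h)) x 1.
Proof.
move=> /cvg_ex [l hl]; apply/cvg_ex; exists l.
by move: hl; under eq_fun do rewrite /= addrA.
Qed.

Lemma smooth_shift f h : smooth f -> smooth (fun x => f (x + h)).
Proof.
by move=> sf k x; rewrite derive1n_shift; apply: derivable_shift; exact: sf.
Qed.

End Derivatives.

Section ColombeauNets.
Variable R : realType.
Local Notation C := (Rcomplex R).

Definition eps := {e : R | 0 < e < 1}.

Let eps_half : 0 < (2^-1 : R) < 1.
Proof. by rewrite invr_gt0 ltr0n invf_lt1 ?ltr1n. Qed.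

HB.instance Definition _ := Choice.copy eps {e : R | 0 < e < 1}.
HB.instance Definition _ := isPointed.Build eps (exist _ 2^-1 eps_half).

(* [e --> 0] inside (0, 1): the trace on [eps] of the filter [0^'+]. *)
Definition eps0 : set_system eps :=
  [set A | \forall e \near (0 : R)^'+, forall he : 0 < e < 1, A (exist _ e he)].

#[global] Instance eps0_filter : ProperFilter eps0.
Proof.
split.
  move=> H.
  have {}H : \forall e \near (0 : R)^'+, 0 < e < 1 -> False by exact: H.
  have [e [/= He [e0 e1]]] :=
    filter_ex (filterI H (filterI (nbhs_right_gt 0) (nbhs_right_lt ltr01))).
  by apply: He; apply/andP.
split.
- by apply: nearW.
- by move=> A B HA HB; apply: (@filterS2 _ ((0 : R)^'+) _ _ _ _ _ HA HB) => e hA hB he; split.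
- by move=> A B AB; apply: (@filterS _ ((0 : R)^'+)) => e hA he; exact/AB.
Qed.

Canonical eps0_filterType := FilterType eps0 _.
Canonical eps0_pfilterType := PFilterType eps0 (filter_not_empty _).

Lemma eps0P (A : set eps) : eps0 A <->
  exists2 eta : R, 0 < eta & forall e : eps, val e < eta -> A e.
Proof.
split=> [[eta /= eta0 H]|[eta eta0 H]].
  exists eta => // -[e he] /= ee; apply: (H e); last by case/andP: he.
  by rewrite /ball_ /= sub0r normrN gtr0_norm //; case/andP: he.
by apply: (@filterS _ ((0 : R)^'+) _ _ _ _ (nbhs_right_lt eta0)) => e ee he; exact: H.
Qed.

Definition net := eps -> R -> C.
HB.instance Definition _ := GRing.ComNzRing.copy net (eps -> R -> C).

(* [supnorm K g] is sup_K |g|, a genuine supremum for [K] compact and nonempty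
   and [g] continuous; it is 0 for [K] empty. *)
Definition supnorm (K : set R) (g : R -> C) : R := sup [set `|g x| | x in K].

Definition smooth_net (u : net) := forall e, smooth (u e).

(* sup_K |u_e^(k)| = O(e^b) as e --> 0, for a real exponent [b]. *)
Definition growth (u : net) (K : set R) (k : nat) (b : R) :=
  (fun e => supnorm K (derive1n k (u e))) =O_eps0 (fun e => val e `^ b).

Definition is_moderate (u : net) := smooth_net u /\
  forall K, compact K -> forall k, exists b, growth u K k b.

Definition is_negligible (u : net) := smooth_net u /\
  forall K, compact K -> forall k b, growth u K k b.


Lemma supnorm_leP (K : set R) (g : R -> C) (M : R) :
  compact K -> continuous g -> 0 <= M ->
  supnorm K g <= M <-> forall x, K x -> `|g x| <= M.
Proof.
move=> cK cg M0; rewrite /supnorm; split=> [H x Kx|H].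
  apply: le_trans H; apply: ub_le_sup; last by exists x.
  have /compact_bounded [B [_ HB]] : compact (g @` K).
    by apply: continuous_compact => //; exact: continuous_subspaceT.
  exists (B + 1) => _ [y Ky <-]; apply: HB; first by rewrite ltrDl.
  by exists y.
have [[x Kx]|/set0P/negP/negPn/eqP K0] := pselect (K !=set0); last first.
  by rewrite K0 image_set0 sup0.
by apply: ge_sup => [|_ [y Ky <-]]; [exists `|g x|, x | exact: H].
Qed.

Lemma supnorm_ge0 (K : set R) (g : R -> C) : 0 <= supnorm K g.
Proof.
rewrite /supnorm; have [[[y [x Kx yE]] ub]|/sup_out E] :=
  pselect (has_sup [set `|g x| | x in K]); last by rewrite E.
by rewrite (le_trans (normr_ge0 (g x))) //; apply: ub_le_sup => //; exists x.
Qed.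

Definition bounded_growth (u : net) (K : set R) (k : nat) (b : R) :=
  exists2 M : R, 0 < M &
    \forall e \near eps0, forall x, K x -> `|derive1n k (u e) x| <= M * val e `^ b.

Lemma growthP (u : net) (K : set R) (k : nat) (b : R) :
  smooth_net u -> compact K -> growth u K k b <-> bounded_growth u K k b.
Proof.
move=> su cK; rewrite /growth eqO_exP; split=> -[M M0 H]; exists M => //.
  apply: filterS H => e; rewrite ger0_norm ?supnorm_ge0 // ger0_norm ?powR_ge0 //.
  move=> H; apply/supnorm_leP => //; first exact: smooth_continuous.
  by rewrite mulr_ge0 ?powR_ge0 // ltW.
apply: filterS H => e H; rewrite ger0_norm ?supnorm_ge0 // ger0_norm ?powR_ge0 //.
apply/supnorm_leP => //; first exact: smooth_continuous.
by rewrite mulr_ge0 ?powR_ge0 // ltW.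
Qed.

Lemma bounded_growth_le (u : net) K k (b b' : R) : b' <= b ->
  bounded_growth u K k b -> bounded_growth u K k b'.
Proof.
move=> bb [M M0 H]; exists M => //; apply: filterS H => e He x Kx.
apply: le_trans (He x Kx) _; rewrite ler_wpM2l ?(ltW M0) //.
by apply: ger_powR => //; case: e {He} => e /= /andP[-> /ltW ->].
Qed.

Lemma bounded_growthD (u v w : net) K k (b : R) :
  (forall e, derive1n k (w e) = derive1n k (u e) + derive1n k (v e)) ->
  bounded_growth u K k b -> bounded_growth v K k b -> bounded_growth w K k b.
Proof.
move=> E [M M0 HM] [N N0 HN]; exists (M + N); first exact: addr_gt0.
apply: filterS2 HM HN => e HM HN x Kx.
rewrite E mulrDl (le_trans (ler_normD _ _)) // lerD //; [exact: HM|exact: HN].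
Qed.

Lemma bounded_growthN (u : net) K k (b : R) : smooth_net u ->
  bounded_growth u K k b -> bounded_growth (- u) K k b.
Proof.
move=> su [M M0 HM]; exists M => //; apply: filterS HM => e HM x Kx.
have -> : (- u) e = cst 0 - u e by rewrite sub0r.
rewrite derive1nB //; last exact: smooth_cst.
have -> : derive1n k (cst 0 : R -> C) = cst 0 by case: k {HM} => // k; rewrite derive1n_cst.
by rewrite sub0r normrN; exact: HM.
Qed.

Definition derive_net (u : net) : net := fun e => derive1 (u e).

Lemma bounded_growth_derive (u : net) K k b :
  bounded_growth (derive_net u) K k b <-> bounded_growth u K k.+1 b.
Proof.
by split=> -[M M0 H]; exists M => //; apply: filterS H => e; rewrite derive1Sn.
Qed.

Lemma derive_net_mul (u v : net) : smooth_net u -> smooth_net v ->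
  derive_net (u * v) = derive_net u * v + u * derive_net v.
Proof. by move=> su sv; apply/funext => e; exact: derive1_mul. Qed.

Lemma bounded_growthM (K : set R) k (u v : net) (a c : R) :
  smooth_net u -> smooth_net v ->
  (forall j, (j <= k)%N -> bounded_growth u K j a) ->
  (forall j, (j <= k)%N -> bounded_growth v K j c) ->
  bounded_growth (u * v) K k (a + c).
Proof.
elim: k u v => [|k IH] u v su sv Hu Hv.
  have [M M0 HM] := Hu 0 isT; have [N N0 HN] := Hv 0 isT.
  exists (M * N); first exact: mulr_gt0.
  apply: filterS2 HM HN => e HM HN x Kx.
  rewrite powRD; last by apply/implyP => _; rewrite gt_eqF //; case/andP: (valP e).
  have -> : `|derive1n 0 ((u * v) e) x| = `|u e x| * `|v e x| by exact: Rcomplex_normM.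
  by rewrite mulrACA; apply: ler_pM => //; [exact: HM | exact: HN].
apply/bounded_growth_derive; rewrite derive_net_mul //.
have su' : smooth_net (derive_net u) by move=> e; exact: smooth_derive1.
have sv' : smooth_net (derive_net v) by move=> e; exact: smooth_derive1.
apply: (@bounded_growthD (derive_net u * v) (u * derive_net v)).
- by move=> e; apply: derive1nD; exact: smoothM.
- apply: IH => // j jk; first by apply/bounded_growth_derive; exact: Hu.
  by apply: Hv; exact: leqW.
- apply: IH => // j jk; last by apply/bounded_growth_derive; exact: Hv.
  by apply: Hu; exact: leqW.
Qed.

Lemma is_moderateP (u : net) : is_moderate u <-> smooth_net u /\
  forall K, compact K -> forall k, exists b, forall j, (j <= k)%N ->
    bounded_growth u K j b.
Proof.
split=> -[su H]; split=> // K cK k.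
  elim: k => [|k [b IH]].
    have [b /growthP Hb] := H K cK 0; exists b => j; rewrite leqn0 => /eqP ->.
    exact: Hb.
  have [b' /growthP Hb'] := H K cK k.+1.
  exists (Num.min b b') => j; rewrite leq_eqVlt => /orP[/eqP ->|].
    by apply: bounded_growth_le (Hb' su cK); rewrite ge_min lexx orbT.
  by rewrite ltnS => /IH; apply: bounded_growth_le; rewrite ge_min lexx.
by have [b /(_ k (leqnn _)) Hb] := H K cK k; exists b; apply/growthP.
Qed.

Lemma is_negligibleP (u : net) : is_negligible u <-> smooth_net u /\
  forall K, compact K -> forall k b, bounded_growth u K k b.
Proof.
by split=> -[su H]; split=> // K cK k b; apply/growthP => //; exact: H.
Qed.

Lemma smooth_netB (u v : net) : smooth_net u -> smooth_net v -> smooth_net (u - v).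
Proof. by move=> su sv e; exact: smoothB. Qed.

Lemma smooth_netM (u v : net) : smooth_net u -> smooth_net v -> smooth_net (u * v).
Proof. by move=> su sv e; exact: smoothM. Qed.

Lemma bounded_growthB (u v : net) K k (b : R) : smooth_net u -> smooth_net v ->
  bounded_growth u K k b -> bounded_growth v K k b -> bounded_growth (u - v) K k b.
Proof.
move=> su sv Hu /(bounded_growthN sv) Hv; apply: bounded_growthD Hu Hv => e.
rewrite -derive1nD //; have -> : (- v) e = cst 0 - v e by rewrite sub0r.
by apply: smoothB => //; exact: smooth_cst.
Qed.

Lemma bounded_growth_cst (c : C) K k : bounded_growth (cst (cst c)) K k 0.
Proof.
exists (`|c| + 1); first by rewrite ltr_wpDl.
apply: nearW => e x _; rewrite powRr0 mulr1.
case: k => [|k]; first by rewrite derive1n0 lerDl.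
by rewrite derive1n_cst normr0 addr_ge0.
Qed.

Definition moderate : {pred net} := [pred u : net | `[< is_moderate u >] ].

Lemma moderate_subring : subring_closed moderate.
Proof.
split.
- apply/asboolP/is_moderateP; split=> [e|K cK k]; first exact: smooth_cst.
  by exists 0 => j _; exact: bounded_growth_cst.
- move=> u v /asboolP/is_moderateP[su Hu] /asboolP/is_moderateP[sv Hv].
  apply/asboolP/is_moderateP; split=> [|K cK k]; first exact: smooth_netB.
  have [a Ha] := Hu K cK k; have [c Hc] := Hv K cK k.
  exists (Num.min a c) => j jk; apply: bounded_growthB => //.
    by apply: bounded_growth_le (Ha j jk); rewrite ge_min lexx.
  by apply: bounded_growth_le (Hc j jk); rewrite ge_min lexx orbT.
- move=> u v /asboolP/is_moderateP[su Hu] /asboolP/is_moderateP[sv Hv].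
  apply/asboolP/is_moderateP; split=> [|K cK k]; first exact: smooth_netM.
  have [a Ha] := Hu K cK k; have [c Hc] := Hv K cK k.
  exists (a + c) => j jk; apply: bounded_growthM => // i ij.
    by apply: Ha; exact: leq_trans jk.
  by apply: Hc; exact: leq_trans jk.
Qed.

Record moderate_net := ModerateNet { net_of :> net; net_ofP : net_of \in moderate }.

HB.instance Definition _ := [isSub for net_of].
HB.instance Definition _ := [Choice of moderate_net by <:].
HB.instance Definition _ :=
  GRing.SubChoice_isSubComNzRing.Build net moderate moderate_net moderate_subring.

(* A negligible net is moderate, so N(R) can be taken inside [moderate_net]. *)
Definition negligible : {pred moderate_net} :=
  [pred u : moderate_net | `[< is_negligible u >] ].

Lemma negligible_ideal : idealr_closed negligible.
Proof.
split.
- apply/asboolP/is_negligibleP; split=> [e|K cK k b]; first exact: smooth_cst.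
  exists 1 => //; apply: nearW => e x _.
  have -> : derive1n k (cst 0 : R -> C) = cst 0 by case: k => // k; rewrite derive1n_cst.
  by rewrite normr0 mul1r powR_ge0.
- apply/negP => /asboolP/is_negligibleP[_ H].
  have [M M0 {}H] := H _ (@compact_set1 _ (0 : R)) 0 1.
  have He : eps0 [set e | M * val e < 1].
    apply/eps0P; exists M^-1; rewrite ?invr_gt0 // => e /=.
    by rewrite -[M^-1]mul1r ltr_pdivlMr // mulrC.
  have [e [/= e1 H1]] := filter_ex (filterI He H).
  have : `|1 : C| <= M * val e `^ 1 by exact: (H1 0 erefl).
  rewrite Rcomplex_norm1 powRr1; last by case/andP: (valP e) => /ltW.
  by rewrite leNgt e1.
- move=> a u v /asboolP/is_negligibleP[su Hu] /asboolP/is_negligibleP[sv Hv].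
  have /asboolP/is_moderateP[sa Ha] := net_ofP a.
  apply/asboolP/is_negligibleP.
  have sau : smooth_net ((a : net) * (u : net)) by exact: smooth_netM.
  split=> [|K cK k b]; first by move=> e; exact: smoothD (sau e) (sv e).
  apply: (@bounded_growthD ((a : net) * (u : net)) v).
  + by move=> e; exact: derive1nD (sau e) (sv e).
  + have [c Hc] := Ha K cK k; rewrite -[b](subrKC c).
    by apply: bounded_growthM => // j _; exact: Hu.
  + exact: Hv.
Qed.

HB.instance Definition _ := isIdealr.Build moderate_net negligible negligible_ideal.


Definition colombeau := {ideal_quot negligible}.

HB.instance Definition _ := GRing.ComNzRing.on colombeau.

Definition shift_net (h : R) (u : net) : net := fun e x => u e (x + h).

Lemma bounded_growth_shift h (u : net) K k b :
  bounded_growth u [set x + h | x in K] k b -> bounded_growth (shift_net h u) K k b.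
Proof.
move=> [M M0 H]; exists M => //; apply: filterS H => e He x Kx.
by rewrite derive1n_shift; apply: He; exists x.
Qed.

Lemma compact_shift h (K : set R) : compact K -> compact [set x + h | x in K].
Proof.
apply: continuous_compact; apply: continuous_subspaceT => x.
by apply: cvgD; [exact: cvg_id | exact: cvg_cst].
Qed.

Lemma smooth_net_shift h (u : net) : smooth_net u -> smooth_net (shift_net h u).
Proof. by move=> su e; exact: smooth_shift. Qed.

Lemma shift_moderate_subproof h (u : moderate_net) : shift_net h u \in moderate.
Proof.
have /asboolP/is_moderateP[su Hu] := net_ofP u.
apply/asboolP/is_moderateP; split=> [|K cK k]; first exact: smooth_net_shift.
have [b Hb] := Hu _ (@compact_shift h K cK) k.
by exists b => j jk; apply: bounded_growth_shift; exact: Hb.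
Qed.

Definition shift_moderate h (u : moderate_net) : moderate_net :=
  ModerateNet (shift_moderate_subproof h u).

(* Independence of the representative is [translateE] below. *)
Definition translate (h : R) (f : colombeau) : colombeau :=
  \pi_colombeau (shift_moderate h (repr f)).

Lemma colombeau_eqP (u v : moderate_net) :
  \pi_colombeau u = \pi_colombeau v <-> is_negligible ((u : net) - (v : net)).
Proof.
split=> [/eqP|H].
  by rewrite -Quotient.idealrBE => /asboolP.
by apply/eqP; rewrite -Quotient.idealrBE; apply/asboolP.
Qed.

Lemma translateE h (u : moderate_net) :
  translate h (\pi_colombeau u) = \pi_colombeau (shift_moderate h u).
Proof.
apply/colombeau_eqP.
have : \pi_colombeau (repr (\pi_colombeau u)) = \pi_colombeau u by exact: reprK.
move/colombeau_eqP/is_negligibleP => [sw Hw]; apply/is_negligibleP.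
split=> [|K cK k b]; first exact: smooth_net_shift sw.
exact: (@bounded_growth_shift h _ K k b (Hw _ (@compact_shift h K cK) k b)).
Qed.

Definition sub_value0 (u : net) : net := fun e x => u e x - u e 0.

(* The choice of the representative is irrelevant: [generalized_constantP]. *)
Definition generalized_constant (f : colombeau) :=
  exists2 u : moderate_net, \pi_colombeau u = f & is_negligible (sub_value0 u).

Lemma generalized_constantP (u : moderate_net) :
  generalized_constant (\pi_colombeau u) <-> is_negligible (sub_value0 u).
Proof.
split=> [[v /colombeau_eqP/is_negligibleP[sw Hw] /is_negligibleP[sv Hv]]|]; last by exists u.
pose w := (v : net) - (u : net).
have s0 : smooth_net (fun e => cst (w e 0)) by move=> e; exact: smooth_cst.
have Hw0 K k b : bounded_growth (fun e => cst (w e 0)) K k b.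
  have [M M0 H] := Hw _ (@compact_set1 _ (0 : R)) 0 b.
  exists M => //; apply: filterS H => e /(_ 0 erefl); rewrite derive1n0 => He x _.
  case: k => [//|k]; rewrite derive1n_cst normr0.
  exact: le_trans (normr_ge0 _) He.
have -> : sub_value0 u = sub_value0 v - (w - (fun e => cst (w e 0))).
  apply/funext => e; apply/funext => x.
  rewrite -[RHS]/((net_of v e x - net_of v e 0) -
    ((net_of v e x - net_of u e x) - (net_of v e 0 - net_of u e 0))).
  suff E (V : zmodType) (p q r t : V) : p - q = (r - t) - ((r - p) - (t - q)) by exact: E.
  by rewrite opprB addrA subrKA opprB addrC subrKA.
have sww0 : smooth_net (w - (fun e => cst (w e 0))) by exact: smooth_netB.
apply/is_negligibleP; split=> [|K cK k b]; first exact: smooth_netB.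
apply: bounded_growthB => //; first exact: Hv.
by apply: bounded_growthB => //; exact: Hw.
Qed.

End ColombeauNets.

(* Main.v *)
Require Import Defs.
From mathcomp Require Import all_boot all_order all_algebra complex.
From mathcomp Require Import all_classical all_reals all_analysis.
From mathcomp Require Import lra ring.

Import Order.TTheory GRing.Theory Num.Theory.
Import numFieldNormedType.Exports.

Local Open Scope classical_set_scope.
Local Open Scope ring_scope.

(** A function with two incommensurable periods [h1] and [h2] has the arbitrarily
    small periods [q h1 - p h2], so it is constant if it is continuous. For nets
    the periods are only approximate, with an error that is smaller than every
    power of [e], and the argument has to be made quantitative.

    Put [a = h1 / h2]. By Dirichlet's theorem ([dirichlet_approximation]), for
    every [Q] there is a [q <= Q] with [|q a - p| <= 1 / Q], and since [a] is
    algebraic and irrational, Liouville's inequality ([liouville]) bounds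
    [|q a - p|] from below by [c / Q ^ d]. Hence [delta = |q h1 - p h2|] is an
    approximate period of size at most [h2 / Q], obtained by adding [O(Q)] of the
    given errors, and any [x] in a fixed segment is within [delta] of a multiple
    [k delta] with [|k| = O(Q ^ d)]. Jumping from [0] to [k delta] costs
    [O(Q ^ (d + 1))] errors, and moving from there to [x] costs at most
    [delta sup |g'|] ([two_periods_estimate]).

    Apply this to the derivatives of a representative, with [Q] close to [e ^ (-s)].
    The last cost is [O(e ^ b)] as soon as [s] is large, because the derivatives
    are moderate; the first one is then only a fixed power of [1 / e] times a
    negligible quantity. So every derivative is constant up to a negligible error
    ([biperiodic_derivatives_constant]). That the derivatives of positive order are
    themselves negligible follows from the mean value theorem: the derivative of
    order [k + 1] is nearly constant on the unit segment and its integral there is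
    an increment of the derivative of order [k], which is small
    ([derive1_small_of_increment]). *)

Set Implicit Arguments.
Unset Strict Implicit.

(** * Diophantine approximation *)

(** Pigeonhole: among the fractional parts of [0], [x], ..., [Q x], two fall in the
    same of the [Q] boxes of length [1 / Q]. *)
Lemma dirichlet_approximation {R : realType} (x : R) (Q : nat) : (0 < Q)%N ->
  exists (q : nat) (p : int),
    [/\ (0 < q)%N, (q <= Q)%N & `|q%:R * x - p%:~R| <= Q%:R^-1].
Proof.
case: Q => // Q _; pose fr (i : nat) := i%:R * x - (Num.floor (i%:R * x))%:~R.
have fr01 i : 0 <= fr i < 1.
  have /andP[] := floor_itv (i%:R * x).
  by rewrite intrD /fr => ? ?; apply/andP; split; lra.
pose box (i : 'I_Q.+2) : 'I_Q.+1 := inord (Num.trunc (Q.+1%:R * fr i)).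
have boxE i : (box i)%:R <= Q.+1%:R * fr i < (box i).+1%:R.
  have /andP[f0 f1] := fr01 i.
  have h0 : 0 <= Q.+1%:R * fr i by rewrite mulr_ge0.
  rewrite /box inordK ?truncn_itv // truncn_lt_nat //.
  by rewrite -[ltRHS]mulr1 ltr_pM2l // ltr0n.
have [/injectiveP inj|/injectivePn [i [j ij eij]]] := boolP (injectiveb box).
  by have := leq_card box inj; rewrite !card_ord ltnn.
wlog lij : i j ij eij / (i < j)%N.
  move=> H; have [|ji|/val_inj E] := ltngtP i j; first exact: H.
  - by apply: (H j i) => //; rewrite eq_sym.
  - by rewrite E eqxx in ij.
exists (j - i)%N, (Num.floor (j%:R * x) - Num.floor (i%:R * x)).
split; first by rewrite subn_gt0.
  by rewrite (leq_trans (leq_subr _ _)) // -ltnS ltn_ord.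
rewrite natrB 1?ltnW // intrB.
rewrite (_ : _ - _ = fr j - fr i); last by rewrite /fr; ring.
have Q0 : 0 < Q.+1%:R :> R by rewrite ltr0n.
rewrite -[_^-1]mul1r ler_pdivlMr // -[X in _ * X]gtr0_norm // -normrM.
have := boxE i; have := boxE j; rewrite eij -!natr1 => /andP[? ?] /andP[? ?].
by rewrite ler_norml; apply/andP; split; lra.
Qed.

Lemma horner_homogeneous_int {R : archiNumFieldType} (P : {poly int}) (p : int) (q : nat) :
  (0 < q)%N ->
  (q%:R ^+ size P * (map_poly intr P).[p%:~R / q%:R] : R) \is a Num.int.
Proof.
move=> q0; have qn0 : q%:R != 0 :> R by rewrite pnatr_eq0 -lt0n.
rewrite (horner_coef_wide _ (size_poly _ _)) mulr_sumr rpred_sum // => i _.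
have qE : q%:R ^+ size P = q%:R ^+ (size P - i) * q%:R ^+ i :> R.
  by rewrite -exprD subnK // ltnW.
rewrite coef_map /= qE expr_div_n.
rewrite (_ : _ * _ = (P`_i)%:~R * (p%:~R ^+ i * q%:R ^+ (size P - i))); last first.
  by field; rewrite expf_neq0.
by rewrite !rpredM ?rpredX ?intr_int // intr_nat.
Qed.

(** Dividing by [X - r] for a rational root [r] keeps the irrational root [a]; the
    division stops for reasons of degree. This replaces the minimal polynomial in
    the proof of Liouville's inequality. *)
Lemma annihilator_without_rational_root {R : realType} (a : R) (P : {poly rat}) :
  irrational a -> P != 0 -> root (map_poly ratr P) a ->
  exists P' : {poly rat}, [/\ P' != 0, root (map_poly ratr P') a & forall r, ~~ root P' r].
Proof.
move=> ia; have [n] := ubnP (size P); elim: n P => // n IH P sP P0 Pa.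
have [[r rP]|nr] := pselect (exists r, root P r); last first.
  by exists P; split => // r; apply/negP => rP; apply: nr; exists r.
have /factor_theorem[G PE] := rP; subst P.
have G0 : G != 0 by apply: contraNneq P0 => ->; rewrite mul0r.
apply: (IH G) => //.
  by move: sP; rewrite size_mul ?polyXsubC_eq0 // size_XsubC addn2 ltnS.
move: Pa; rewrite rmorphM /= map_polyXsubC rootM root_XsubC => /orP[//|/eqP aE].
by case: ia; exists r.
Qed.

(** If [Z] is an integer polynomial without rational roots and [Z(a) = 0], then
    [q ^ n Z(p / q)] is a nonzero integer, of modulus at least [1], whereas
    [Z(p / q)] is [p / q - a] times a factor that is bounded near [a]. *)
Lemma liouville {R : realType} (a : R) :
  irrational a -> algebraicOver (ratr : rat -> R) a ->
  exists (c : R) (d : nat), 0 < c /\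
    forall (q : nat) (p : int), (0 < q)%N -> c / q%:R ^+ d <= `|q%:R * a - p%:~R|.
Proof.
move=> ia [P0 P0n /(annihilator_without_rational_root ia P0n) [P [Pn Pa Pr]]].
have [Z [k k0 PE]] := rat_poly_scale P.
have /factor_theorem[G GE] := Pa.
have [ub Hub] := poly_disk_bound G (`|a| + 1).
pose B := Num.max ub 1; have B1 : 1 <= B by rewrite le_max lexx orbT.
have B0 : 0 < B by lra.
have kR : 0 < `|k%:~R : R| by rewrite normr_gt0 intr_eq0.
exists (Num.min 1 (`|k%:~R| * B)^-1), (size Z); split.
  by rewrite lt_min ltr01 invr_gt0 mulr_gt0.
move=> q p q0; have qR : 1 <= q%:R :> R by rewrite ler1n.
have qR0 : 0 < q%:R :> R by lra.
have qd : 1 <= q%:R ^+ size Z :> R by rewrite exprn_ege1.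
have qd0 : 0 < q%:R ^+ size Z :> R by lra.
rewrite ler_pdivrMr //.
have aq : `|q%:R * a - p%:~R| = q%:R * `|p%:~R / q%:R - a|.
  rewrite -[X in _ = X * _]gtr0_norm // -normrM distrC; congr (`| _ |).
  by field; rewrite gt_eqF.
have le_aq : `|p%:~R / q%:R - a| <= `|q%:R * a - p%:~R|.
  by rewrite aq ler_peMl.
(* The cofactor [G] is bounded by [B] only at distance at most [1] from [a]. *)
have [far|near] := lerP 1 `|p%:~R / q%:R - a|.
  rewrite ge_min; apply/orP; left.
  by rewrite -[leLHS]mulr1 ler_pM // (le_trans far).
rewrite ge_min; apply/orP; right.
apply: (@le_trans _ _ (`|p%:~R / q%:R - a| * q%:R ^+ size Z)); last first.
  by rewrite ler_pM2r.
have pqE : p%:~R / q%:R = ratr (p%:~R / q%:R) :> R.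
  by rewrite fmorph_div /= rmorph_int rmorph_nat.
have ZE : (map_poly intr Z : {poly R}).[p%:~R / q%:R] =
    k%:~R * (map_poly ratr P).[p%:~R / q%:R].
  rewrite PE map_polyZ /= hornerZ fmorphV /= rmorph_int mulrA divff ?mul1r ?intr_eq0 //.
  by rewrite -map_poly_comp (eq_map_poly (g := intr)) // => z; rewrite /= rmorph_int.
have Zint : (1 : R) <= `|q%:R ^+ size Z * (k%:~R * (map_poly ratr P).[p%:~R / q%:R])|.
  apply: norm_intr_ge1; first by rewrite -ZE horner_homogeneous_int.
  apply: mulf_neq0; first by rewrite gt_eqF.
  apply: mulf_neq0; first by rewrite intr_eq0.
  by rewrite pqE horner_map fmorph_eq0; exact: Pr.
rewrite -[leLHS]mul1r ler_pdivrMr ?mulr_gt0 //.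
apply: le_trans Zint _; rewrite GE hornerM !normrM hornerXsubC ger0_norm ?(ltW qd0) //.
have GB : `|G.[p%:~R / q%:R]| <= B.
  rewrite le_max Hub //.
  have := ler_normD (p%:~R / q%:R - a) a; rewrite subrK; lra.
rewrite mulrA [leLHS]mulrC.
rewrite (_ : _ * (_ * B) = `|p%:~R / q%:R - a| * q%:R ^+ size Z * `|k%:~R| * B); last by ring.
rewrite [leLHS](_ : _ =
    `|p%:~R / q%:R - a| * q%:R ^+ size Z * `|k%:~R| * `|G.[p%:~R / q%:R]|); last by ring.
by rewrite ler_wpM2l // !mulr_ge0 // ltW.
Qed.

(** * Approximate periods on a segment *)

(** Both ends of the translation must lie in the segment; this makes the notion
    invariant under changing the sign of [h]. *)
Definition almost_period {R : realType} {V : normedZmodType R}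
    (g : R -> V) (L eta h : R) :=
  forall x, `|x| <= L -> `|x + h| <= L -> `|g (x + h) - g x| <= eta.

Lemma almost_periodN {R : realType} {V : normedZmodType R} (g : R -> V) (L eta h : R) :
  almost_period g L eta h -> almost_period g L eta (- h).
Proof. by move=> H x xL xhL; rewrite distrC -{1}(subrK h x) H ?subrK. Qed.

(** The walk from [x] to [x + m h1 - n h2] never has to leave the segment: make a
    step [h1] whenever this is possible, else a step [- h2]. If both were blocked
    although steps of both kinds remain, the segment would be shorter than
    [h1 + h2]; if only one kind remains, the target would be outside. *)
Lemma almost_period_comb {R : realType} {V : normedZmodType R} (g : R -> V)
    (L eta h1 h2 : R) (m n : nat) :
  0 < h1 -> 0 < h2 -> h1 + h2 <= 2 * L ->
  almost_period g L eta h1 -> almost_period g L eta h2 ->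
  almost_period g L ((m + n)%:R * eta) (m%:R * h1 - n%:R * h2).
Proof.
move=> h10 h20 hL H1 /almost_periodN H2 x.
have [N] := ubnP (m + n); elim: N m n x => // N IH m n x.
have step (h : R) (k : nat) y : almost_period g L eta h ->
    `|x| <= L -> `|x + h| <= L ->
    `|g y - g (x + h)| <= k%:R * eta -> `|g y - g x| <= k.+1%:R * eta.
  move=> Hh xL xhL Hy; rewrite -(subrK (g (x + h)) (g y)) -addrA.
  by rewrite (le_trans (ler_normD _ _)) // -natr1 mulrDl mul1r lerD // Hh.
rewrite ltnS => mnN xL yL.
have [/andP[m0 xh1]|nh1] := boolP ((0 < m)%N && (x + h1 <= L)).
  case: m m0 mnN yL => // m _ mnN yL; rewrite addSn.
  have E : x + (m.+1%:R * h1 - n%:R * h2) = (x + h1) + (m%:R * h1 - n%:R * h2).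
    by rewrite -natr1; ring.
  have xh1L : `|x + h1| <= L by move: xL; rewrite !ler_norml => /andP[? ?]; lra.
  apply: (step h1) => //; rewrite E; apply: IH => //.
  by rewrite -E.
have [/andP[n0 xh2]|nh2] := boolP ((0 < n)%N && (- L <= x - h2)).
  case: n n0 mnN yL nh1 => // n _ mnN yL _; rewrite addnS.
  have E : x + (m%:R * h1 - n.+1%:R * h2) = (x - h2) + (m%:R * h1 - n%:R * h2).
    by rewrite -natr1; ring.
  have xh2L : `|x - h2| <= L by move: xL; rewrite !ler_norml => /andP[? ?]; lra.
  apply: (step (- h2)) => //; rewrite E; apply: IH => //; last by rewrite -E.
  by rewrite addnS in mnN.
move: nh1 nh2 xL yL; rewrite !ler_norml => nh1 nh2 /andP[x1 x2] /andP[y1 y2].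
case: m n nh1 nh2 y1 y2 mnN => [|m] [|n] /=; rewrite -?ltNge.
- by move=> *; rewrite !mul0r subr0 addr0 subrr normr0.
- move=> _ ? y1; have : 0 <= n%:R * h2 by rewrite mulr_ge0 // ltW.
  by move: y1; rewrite -natr1; lra.
- move=> ? _ y1 y2; have : 0 <= m%:R * h1 by rewrite mulr_ge0 // ltW.
  by move: y2; rewrite -natr1; lra.
- by lra.
Qed.

(** The constants depend on the segment and the periods only, not on [g] or [Q]:
    this is what allows [Q] to vary with [e]. *)
Lemma two_periods_estimate {R : realType} (h1 h2 L : R) :
  0 < h1 -> 0 < h2 -> h1 + h2 <= L ->
  irrational (h1 / h2) -> algebraicOver (ratr : rat -> R) (h1 / h2) ->
  exists (C : R) (d : nat), 0 < C /\
    forall (V : normedZmodType R) (g : R -> V) (A eta : R) (Q : nat), (0 < Q)%N ->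
    0 <= eta ->
    almost_period g L eta h1 -> almost_period g L eta h2 ->
    (forall x y, `|x| <= L -> `|y| <= L -> `|g x - g y| <= A * `|x - y|) ->
    forall x, `|x| <= L -> `|g x - g 0| <= C * (A / Q%:R + Q%:R ^+ d * eta).
Proof.
move=> h10 h20 hL irr alg; set a := h1 / h2 in irr alg.
have [c [d [c0 Hc]]] := liouville irr alg.
have a0 : 0 < a by rewrite divr_gt0.
have h1E : h1 = a * h2 by rewrite /a divfK // gt_eqF.
have L0 : 0 < L by lra.
have C20 : 0 < L / (c * h2) * (a + 2) by rewrite !mulr_gt0 ?invr_gt0 ?mulr_gt0 //; lra.
exists (h2 + L / (c * h2) * (a + 2)), d.+1; split; first by rewrite addr_gt0.
move=> V g A eta Q Q0 eta0 ap1 ap2 lip x xL.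
have [q [p [q0 qQ apx]]] := dirichlet_approximation a Q0.
have QR : 1 <= Q%:R :> R by rewrite ler1n.
have QV : Q%:R^-1 <= 1 :> R by rewrite invf_le1; lra.
have qR : 1 <= q%:R :> R by rewrite ler1n.
have qQR : q%:R <= Q%:R :> R by rewrite ler_nat.
have low := Hc q p q0.
have A0 : 0 <= A.
  have L_L : `|L| <= L by rewrite gtr0_norm.
  have Z_L : `|0 : R| <= L by rewrite normr0 ltW.
  have := le_trans (normr_ge0 _) (lip L 0 L_L Z_L).
  by rewrite subr0 gtr0_norm // pmulr_lge0.
have [n pn] : exists n : nat, p = n%:Z.
  case: p apx low => n apx _; first by exists n.
  move: apx; rewrite NegzE mulrNz opprK => /(le_trans (ler_norm _)).
  have : 0 < q%:R * a by rewrite mulr_gt0 //; lra.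
  by rewrite -pmulrn -natr1; have : 0 <= n%:R :> R by []; lra.
subst p; rewrite -pmulrn in apx low.
have qn : (q + n)%:R <= Q%:R * (a + 2) :> R.
  have := le_trans (ler_norm _) (eq_ind _ (fun z => z <= _) apx _ (distrC _ _)).
  rewrite natrD => nq; have : q%:R * a <= Q%:R * a by rewrite ler_wpM2r // ltW.
  by lra.
pose dl := `|q%:R * a - n%:R| * h2.
have dlE : dl = `|q%:R * h1 - n%:R * h2|.
  by rewrite /dl h1E mulrA -mulrBl normrM (gtr0_norm h20).
have qd0 : 0 < q%:R ^+ d :> R by rewrite exprn_gt0 //; lra.
have dl0 : 0 < dl by rewrite mulr_gt0 // (lt_le_trans _ low) // divr_gt0.
have dlQ : dl <= h2 / Q%:R by rewrite /dl mulrC ler_wpM2l // ltW.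
have dlL : dl <= L.
  have : h2 / Q%:R <= h2 by rewrite ler_piMr // ltW.
  lra.
have ap_dl : almost_period g L ((q + n)%:R * eta) dl.
  have h12 : h1 + h2 <= 2 * L by lra.
  have ap := almost_period_comb (m := q) (n := n) h10 h20 h12 ap1 ap2.
  by rewrite dlE; case: (ger0P (q%:R * h1 - n%:R * h2)) => _ //; exact: almost_periodN.
pose k := Num.trunc (`|x| / dl).
have xd0 : 0 <= `|x| / dl by rewrite divr_ge0 // ltW.
have /andP[k1 k2] := truncn_itv xd0; rewrite -/k in k1 k2.
rewrite ler_pdivlMr // in k1; rewrite ltr_pdivrMr // -natr1 mulrDl mul1r in k2.
have kd0 : 0 <= k%:R * dl by rewrite mulr_ge0 // ltW.
have ap_k : almost_period g L (k%:R * ((q + n)%:R * eta)) (k%:R * dl).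
  have dl2 : dl + dl <= 2 * L by lra.
  have := almost_period_comb (m := k) (n := 0) dl0 dl0 dl2 ap_dl ap_dl.
  by rewrite mul0r subr0 addn0.
(* [z] is the multiple of [dl] next to [x], on the side of [0]. *)
have [z [z1 z2 z3]] : exists z, [/\ `|z| <= L, `|x - z| <= dl &
    `|g z - g 0| <= k%:R * ((q + n)%:R * eta)].
  have Z_L : `|0 : R| <= L by rewrite normr0 ltW.
  have [x0|x0] := leP 0 x.
    exists (k%:R * dl); rewrite ger0_norm // in xL k1 k2.
    have kL : `|k%:R * dl| <= L by rewrite ger0_norm //; lra.
    split => //; first by rewrite ger0_norm; lra.
    by have := ap_k 0 Z_L; rewrite add0r; apply.
  exists (- (k%:R * dl)); rewrite ltr0_norm // in xL k1 k2.
  have kL : `|- (k%:R * dl)| <= L by rewrite normrN ger0_norm //; lra.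
  split => //; first by rewrite opprK ler_norml; apply/andP; split; lra.
  by have := almost_periodN ap_k Z_L; rewrite add0r; apply.
have k3 : k%:R <= L / (c * h2) * Q%:R ^+ d.
  have cd : c * h2 <= dl * Q%:R ^+ d.
    rewrite ler_pdivrMr // in low.
    rewrite /dl mulrAC ler_wpM2r ?(ltW h20) //; apply: le_trans low _.
    by rewrite ler_wpM2l // lerXn2r // nnegrE; lra.
  rewrite mulrAC ler_pdivlMr ?mulr_gt0 //.
  apply: le_trans (ler_wpM2l _ cd) _ => //.
  rewrite mulrA ler_wpM2r // ?exprn_ge0 //; lra.
have qneta : (q + n)%:R * eta <= Q%:R * (a + 2) * eta by rewrite ler_wpM2r.
rewrite -(subrK (g z) (g x)) -addrA (le_trans (ler_normD _ _)) //.
have B1 : `|g x - g z| <= h2 * (A / Q%:R).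
  apply: le_trans (lip _ _ xL z1) _; rewrite mulrCA ler_wpM2l //.
  exact: le_trans z2 dlQ.
have B2 : `|g z - g 0| <= L / (c * h2) * (a + 2) * (Q%:R ^+ d.+1 * eta).
  apply: le_trans z3 _; apply: le_trans (ler_wpM2l _ qneta) _ => //.
  have : 0 <= Q%:R * (a + 2) * eta by rewrite !mulr_ge0 //; lra.
  move=> /ler_wpM2r/(_ _ _ k3)/le_trans; apply.
  by rewrite le_eqVlt; apply/orP; left; apply/eqP; rewrite exprS; ring.
have P1 : 0 <= h2 * (Q%:R ^+ d.+1 * eta).
  by rewrite !mulr_ge0 ?exprn_ge0 // ltW.
have P2 : 0 <= L / (c * h2) * (a + 2) * (A / Q%:R) by rewrite mulr_ge0 ?divr_ge0 // ltW.
lra.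
Qed.

(** * Mean value theorem for complex-valued functions *)

Lemma derive_component {R : realType} (phi : {linear Rcomplex R -> R})
    (g : R -> Rcomplex R) x :
  (forall z, `|phi z| <= `|z|) -> derivable g x 1 ->
  is_derive x 1 (phi \o g) (phi (derive1 g x)).
Proof.
move=> phi1 dg.
have Dg : h^-1 *: (g (h + x) - g x) @[h --> (0 : R)^'] --> derive1 g x.
  rewrite derive1E; move: dg => /cvg_ex [l hl]; rewrite /derive (cvg_lim _ hl) //.
  by move: hl; under eq_fun do rewrite /= [_%:A]mulr1.
have phiC : continuous phi.
  move=> z; apply/(@cvgrPdist_le _ _ _ (nbhs z) (@nbhs_filter (Rcomplex R) z)) => e e0.
  apply/nbhs_normP; exists e => // t /ltW zt.
  by rewrite -raddfB (le_trans (phi1 _)).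
have key : h^-1 *: (((phi \o g) \o shift x) (h *: 1) - (phi \o g) x) @[h --> (0 : R)^'] -->
    phi (derive1 g x).
  have H : phi (h^-1 *: (g (h + x) - g x)) @[h --> (0 : R)^'] --> phi (derive1 g x).
    exact: cvg_comp Dg (phiC _).
  apply: cvg_trans H.
  apply: near_eq_cvg; apply: nearW => h.
  by rewrite /= [h%:A]mulr1 linearZ /= raddfB.
apply: DeriveDef; first by apply/cvg_ex; eexists; exact: key.
exact: cvg_lim key.
Qed.

(** The mean value theorem fails for complex values; it is applied to the real and
    imaginary parts, the two instances of [phi]. *)
Lemma component_MVT {R : realType} (phi : {linear Rcomplex R -> R})
    (g : R -> Rcomplex R) (x y : R) :
  (forall z, `|phi z| <= `|z|) -> (forall t, derivable g t 1) -> x <= y ->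
  exists2 c, x <= c <= y & phi (g y - g x) = phi (derive1 g c) * (y - x).
Proof.
move=> phi1 dg xy.
have D (t : R) : is_derive t (1 : R) (phi \o g) (phi (derive1 g t)) by exact: derive_component.
have [|c] := @MVT_segment R (phi \o g) (fun t => phi (derive1 g t)) x y xy.
  apply: continuous_subspaceT => t; apply/differentiable_continuous/derivable1_diffP.
  by have [] := D t.
by rewrite in_itv /= => cxy E; exists c => //; rewrite raddfB.
Qed.

Lemma norm_Re_le {R : realType} (z : Rcomplex R) : `|complex.Re z| <= `|z|.
Proof.
by case: z => a b; rewrite [leRHS]/Num.norm /= -sqrtr_sqr ler_wsqrtr // lerDl sqr_ge0.
Qed.

Lemma norm_Im_le {R : realType} (z : Rcomplex R) : `|complex.Im z| <= `|z|.
Proof.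
by case: z => a b; rewrite [leRHS]/Num.norm /= -sqrtr_sqr ler_wsqrtr // lerDr sqr_ge0.
Qed.

Lemma norm_le_Re_Im {R : realType} (z : Rcomplex R) :
  `|z| <= `|complex.Re z| + `|complex.Im z|.
Proof.
case: z => a b; rewrite [leLHS]/Num.norm /=.
rewrite -[leRHS]ger0_norm ?addr_ge0 // -sqrtr_sqr ler_wsqrtr // sqrrD !real_normK ?num_real //.
by rewrite addrAC lerDl mulrn_wge0 // mulr_ge0.
Qed.

(** The factor [2] comes from adding the real and imaginary parts. *)
Lemma derive1_bound_lipschitz {R : realType} (g : R -> Rcomplex R) (L A : R) :
  (forall t, derivable g t 1) -> (forall t, `|t| <= L -> `|derive1 g t| <= A) ->
  forall x y, `|x| <= L -> `|y| <= L -> `|g x - g y| <= 2 * A * `|x - y|.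
Proof.
move=> dg gA.
have main x y : `|x| <= L -> `|y| <= L -> x <= y -> `|g y - g x| <= 2 * A * (y - x).
  move=> xL yL xy.
  have part (phi : {linear Rcomplex R -> R}) :
      (forall z, `|phi z| <= `|z|) -> `|phi (g y - g x)| <= A * (y - x).
    move=> phi1; have [c /andP[c1 c2] ->] := component_MVT phi1 dg xy.
    rewrite normrM [X in _ * X]ger0_norm ?subr_ge0 // ler_wpM2r ?subr_ge0 //.
    apply: le_trans (phi1 _) (gA _ _).
    by move: xL yL; rewrite !ler_norml => /andP[? ?] /andP[? ?]; apply/andP; split; lra.
  have HRe := part (@complex.Re R) (@norm_Re_le R).
  have HIm := part (@complex.Im R) (@norm_Im_le R).
  have := norm_le_Re_Im (g y - g x).
  by lra.
move=> x y xL yL; have [xy|yx] := leP x y.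
  by rewrite distrC [`|x - y|]distrC [`|y - x|]ger0_norm ?subr_ge0 // main.
by rewrite [`|x - y|]ger0_norm ?subr_ge0 ?main // ltW.
Qed.

(** For each part [phi], the increment of [phi g] on the unit segment is the value
    of [phi g'] at some point, which is close to the value at [0]. *)
Lemma derive1_small_of_increment {R : realType} (g : R -> Rcomplex R) (M : R) :
  (forall t, derivable g t 1) ->
  (forall t, 0 <= t <= 1 -> `|derive1 g t - derive1 g 0| <= M) ->
  `|g 1 - g 0| <= M -> `|derive1 g 0| <= 4 * M.
Proof.
move=> dg d1 g1.
have part (phi : {linear Rcomplex R -> R}) :
    (forall z, `|phi z| <= `|z|) -> `|phi (derive1 g 0)| <= 2 * M.
  move=> phi1; have [c c01 E] := component_MVT phi1 dg (@ler01 R).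
  rewrite subr0 mulr1 in E.
  have := ler_normB (phi (derive1 g c)) (phi (derive1 g c - derive1 g 0)).
  rewrite raddfB opprB addrC subrK -raddfB -E.
  have := le_trans (phi1 _) (d1 c c01); have := le_trans (phi1 _) g1.
  by lra.
have HRe := part (@complex.Re R) (@norm_Re_le R).
have HIm := part (@complex.Im R) (@norm_Im_le R).
have := norm_le_Re_Im (derive1 g 0).
by lra.
Qed.

(** * Nets with two periods *)

Section Nets.
Variable R : realType.
Implicit Types (u : net R) (k : nat) (L b h : R).

Lemma compact_sub_segment (K : set R) L0 : compact K ->
  exists2 L, L0 <= L & forall x, K x -> `|x| <= L.
Proof.
move=> /compact_bounded [B [_ HB]]; exists (Num.max L0 (B + 1)).
  by rewrite le_max lexx.
have BB : B < B + 1 by rewrite ltrDl.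
by move=> x Kx; rewrite le_max (HB _ BB x Kx) orbT.
Qed.

Lemma bounded_growth_segment u L k b : bounded_growth u `[- L, L] k b <->
  exists2 M : R, 0 < M &
    \forall e \near @eps0 R, forall x, `|x| <= L -> `|derive1n k (u e) x| <= M * val e `^ b.
Proof.
by split=> -[M M0 H]; exists M => //; apply: filterS H => e H x Hx; apply: H;
  move: Hx; rewrite /= in_itv /= -ler_norml.
Qed.

(** Approximate periods can be negated, so the periods may be taken positive:
    [h1] and [h2] have the same sign and [|h1| / |h2| = h1 / h2]. *)
Lemma negligible_almost_period u h : smooth_net u ->
  is_negligible (shift_net h u - u) -> forall L k b, exists2 M, 0 < M &
  \forall e \near @eps0 R, almost_period (derive1n k (u e)) L (M * val e `^ b) `|h|.
Proof.
move=> su /is_negligibleP[_ Hn] L k b.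
have /bounded_growth_segment[M M0 H] := Hn _ (@segment_compact _ (- L) L) k b.
exists M => //; apply: filterS H => e H.
suff ap : almost_period (derive1n k (u e)) L (M * val e `^ b) h.
  by case: (ger0P h) => _ //; exact: almost_periodN.
move=> x xL _; have := H x xL.
rewrite -[(shift_net h u - u) e]/((shift_net h u) e - u e) derive1nB //; last exact: smooth_shift.
by rewrite /shift_net derive1n_shift.
Qed.

Lemma eps_gt0 (e : eps R) : 0 < val e.
Proof. by case/andP: (valP e). Qed.

(** The bound of [two_periods_estimate] is used with [Q] between [e ^ (-s)] and
    [2 e ^ (-s)]. If the derivative of order [k + 1] is [O(e ^ a)], the choice
    [s = |b - a|] makes the first term [O(e ^ b)], and periodicity up to
    [O(e ^ (b + s d))] does the same for the second. *)
Lemma biperiodic_derivatives_constant u h1 h2 k L b :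
  smooth_net u -> (forall K, compact K -> forall k, exists a, bounded_growth u K k a) ->
  is_negligible (shift_net h1 u - u) -> is_negligible (shift_net h2 u - u) ->
  0 < h1 / h2 -> irrational (h1 / h2) -> algebraicOver (ratr : rat -> R) (h1 / h2) ->
  `|h1| + `|h2| <= L ->
  exists2 M : R, 0 < M & \forall e \near @eps0 R,
    forall x, `|x| <= L -> `|derive1n k (u e) x - derive1n k (u e) 0| <= M * val e `^ b.
Proof.
move=> su mu n1 n2 h0 irr alg hL.
have hE : `|h1| / `|h2| = h1 / h2 by rewrite -normfV -normrM gtr0_norm.
have h10 : 0 < `|h1|.
  by rewrite normr_gt0; apply: contraTneq h0 => ->; rewrite mul0r ltxx.
have h20 : 0 < `|h2|.
  by rewrite normr_gt0; apply: contraTneq h0 => ->; rewrite invr0 mulr0 ltxx.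
rewrite -hE in irr alg.
have [C [d [C0 est]]] := two_periods_estimate h10 h20 hL irr alg.
have [a /bounded_growth_segment[M1 M10 H1]] := mu _ (@segment_compact _ (- L) L) k.+1.
pose s := `|b - a|.
have [M2 M20 H2] := negligible_almost_period su n1 L k (b + s * d%:R).
have [M3 M30 H3] := negligible_almost_period su n2 L k (b + s * d%:R).
exists (C * (2 * M1 + 2 ^+ d * (M2 + M3))).
  by rewrite !(mulr_gt0, addr_gt0, exprn_gt0) //; lra.
apply: filterS3 H1 H2 H3 => e H1 H2 H3 x xL.
have e0 := eps_gt0 e.
have e1 : val e <= 1 by case/andP: (valP e) => _ /ltW.
pose y := val e `^ (- s).
have y1 : 1 <= y.
  rewrite -(powRr0 (val e)). apply: ger_powR; rewrite ?e0 //. by rewrite oppr_le0 normr_ge0.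
pose Q := (Num.trunc y).+1.
have yQ : y <= Q%:R by rewrite ltW // truncnS_gt.
have Qy : Q%:R <= 2 * y.
  have : (Num.trunc y)%:R <= y by rewrite truncn_le; lra.
  by rewrite /Q -natr1; lra.
pose B := val e `^ (b + s * d%:R).
have B0 : 0 <= B by exact: powR_ge0.
have widen (M h : R) : 0 < M -> M <= M2 + M3 ->
    almost_period (derive1n k (u e)) L (M * B) h ->
    almost_period (derive1n k (u e)) L ((M2 + M3) * B) h.
  by move=> ? ? H t t1 t2; apply: le_trans (H t t1 t2) _; rewrite ler_wpM2r.
have Lip := derive1_bound_lipschitz (su e k) (fun t tL => H1 t tL).
have eta0 : 0 <= (M2 + M3) * B by rewrite mulr_ge0 //; lra.
have le2 : M2 <= M2 + M3 by lra.
have le3 : M3 <= M2 + M3 by lra.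
have := est _ _ _ _ Q isT eta0 (widen _ _ M20 le2 H2) (widen _ _ M30 le3 H3) Lip x xL.
move=> /le_trans; apply; rewrite -[leRHS]mulrA; apply: ler_wpM2l; first exact: ltW.
rewrite [leRHS]mulrDl.
have eb : val e `^ b = B * y ^+ d.
  rewrite -powR_mulrn ?powR_ge0 // -powRrM -powRD.
    by rewrite mulNr addrK.
  by apply/implyP => _; rewrite gt_eqF.
apply: lerD.
  have Q0 : 0 < Q%:R :> R by rewrite ltr0n.
  rewrite ler_pdivrMr // -!mulrA !ler_wpM2l //; first by lra.
  apply: (@le_trans _ _ (val e `^ b * y)); last by rewrite ler_wpM2l ?powR_ge0.
  rewrite -powRD; last by apply/implyP => _; rewrite gt_eqF.
  apply: ger_powR; rewrite ?e0 //.
  by have := ler_norm (b - a); rewrite -/s; lra.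
rewrite eb [leRHS](_ : _ = (2 * y) ^+ d * ((M2 + M3) * B)); last by rewrite exprMn; ring.
by rewrite ler_wpM2r // lerXn2r // nnegrE; lra.
Qed.

(** The derivatives of [u - u(0)] of positive order are those of [u]; they are
    close to their values at [0], which are small because lower derivatives
    change little. *)
Lemma biperiodic_constant u h1 h2 :
  is_moderate u ->
  is_negligible (shift_net h1 u - u) -> is_negligible (shift_net h2 u - u) ->
  0 < h1 / h2 -> irrational (h1 / h2) -> algebraicOver (ratr : rat -> R) (h1 / h2) ->
  is_negligible (sub_value0 u).
Proof.
move=> [su mu] n1 n2 h0 irr alg.
have bu K : compact K -> forall k, exists a, bounded_growth u K k a.
  by move=> cK k; have [a /growthP Ha] := mu K cK k; exists a; exact: Ha.
have sE e : sub_value0 u e = u e - cst (u e 0) by [].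
apply/is_negligibleP; split=> [e|K cK k b].
  by rewrite sE; apply: smoothB => //; exact: smooth_cst.
have [L L0 KL] := compact_sub_segment (1 + (`|h1| + `|h2|)) cK.
have [L1 hL] : 1 <= L /\ `|h1| + `|h2| <= L.
  by have := normr_ge0 h1; have := normr_ge0 h2; split; lra.
have const j := biperiodic_derivatives_constant j b su bu n1 n2 h0 irr alg hL.
case: k => [|k].
  have [M M0 H] := const 0%N; exists M => //; apply: filterS H => e H x Kx.
  exact: H (KL _ Kx).
have [M M0 H] := const k; have [N N0 H'] := const k.+1.
exists (4 * (M + N) + N); first by lra.
apply: filterS2 H H' => e H H' x Kx.
have E0 : 0 <= val e `^ b by exact: powR_ge0.
rewrite sE derive1nB ?derive1n_cst ?subr0 //; last exact: smooth_cst.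
have D0 : `|derive1n k.+1 (u e) 0| <= 4 * ((M + N) * val e `^ b).
  rewrite derive1nS; apply: derive1_small_of_increment => [t|t /andP[t0 t1]|].
  - exact: su.
  - rewrite -derive1nS; apply: le_trans (H' t _) _; first by rewrite ger0_norm //; lra.
    by rewrite ler_wpM2r //; lra.
  - apply: le_trans (H 1 _) _; first by rewrite normr1.
    by rewrite ler_wpM2r //; lra.
have := H' x (KL _ Kx).
have := ler_normD (derive1n k.+1 (u e) x - derive1n k.+1 (u e) 0) (derive1n k.+1 (u e) 0).
rewrite subrK; lra.
Qed.

End Nets.

Theorem mainTheorem6 (R : realType) (f : colombeau R) (h1 h2 : R)
    (per1 : translate h1 f = f) (per2 : translate h2 f = f)
    (ratio_gt0 : 0 < h1 / h2)
    (ratio_irrational : irrational (h1 / h2))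
    (ratio_algebraic : algebraicOver (ratr : rat -> R) (h1 / h2)) :
  generalized_constant f.
Proof.
have period h : translate h f = f ->
    is_negligible (shift_net h (repr f) - net_of (repr f)).
  by move=> per; apply/(@colombeau_eqP _ (shift_moderate h (repr f))); rewrite reprK.
exists (repr f); first exact: reprK.
have /asboolP mf := net_ofP (repr f).
exact: biperiodic_constant mf (period _ per1) (period _ per2) _ _ _.
Qed.
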